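(* Let $G$ be a connected graph on $n\ge2$ vertices with resistance Laplacian $\mathcal R$, and let $\rho=\lambda_{\max}(\mathcal R)$ be its largest eigenvalue. Then \[ \rho=\max_{\substack{w\in\mathbf 1^\perp\\ \|w\|=1}} w^\top\mathcal R w . \] Moreover, \[ \rho=2n\bar d+\max_{\substack{w\in\mathbf 1^\perp\\ \|w\|=1}}\bigl(2w^\top L^\dagger w+n\,w^\top\Delta w\bigr). \]
   Context: $G=(V,E)$ is a finite, simple, connected, undirected, unweighted graph with vertex set $V=\{1,\dots,n\}$. $L=D_G-A$ is its combinatorial Laplacian (degree matrix minus adjacency matrix). $\mathbf 1\in\mathbb R^n$ is the all-ones vector, $I$ the identity matrix, $\|\cdot\|$ the Euclidean norm. $L^\dagger$ is the Moore--Penrose inverse of $L$, i.e. the unique symmetric matrix with $LL^\dagger=L^\dagger L=I-\frac1n\mathbf 1\mathbf 1^\top$ and $L^\dagger\mathbf 1=\mathbf 0$. The effective resistance is $r_{ij}=(L^\dagger)_{ii}+(L^\dagger)_{jj}-2(L^\dagger)_{ij}$, the resistance matrix is $R=(r_{ij})$, and the resistance Laplacian is $\mathcal R=\operatorname{diag}(R\mathbf 1)-R$. Put $d_i=(L^\dagger)_{ii}$, $D=\operatorname{diag}(d_1,\dots,d_n)$, $\bar d=\frac1n\operatorname{tr}(L^\dagger)$, $\Delta=D-\bar d I$ (resistance deviation matrix). *)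

(* Defs.v *)
From mathcomp Require Import all_boot all_order all_algebra.
From mathcomp Require Import all_classical all_reals.

Set Implicit Arguments.
Unset Strict Implicit.
Unset Printing Implicit Defensive.

Import Order.TTheory GRing.Theory Num.Theory.
Local Open Scope classical_set_scope.
Local Open Scope ring_scope.

(* A finite simple graph on n vertices is a symmetric irreflexive relation on
   'I_n; [connect] is the reflexive-transitive closure from fingraph. *)
Definition simple_graph n (e : rel 'I_n) : Prop := symmetric e /\ irreflexive e.

Definition connected_graph n (e : rel 'I_n) : Prop :=
  forall i j, connect e i j.

Definition degree n (e : rel 'I_n) (i : 'I_n) : nat := #|[set j | e i j]%SET|.

Definition adjacency (R : realType) n (e : rel 'I_n) : 'M[R]_n :=
  \matrix_(i, j) (e i j)%:R.

Definition laplacian (R : realType) n (e : rel 'I_n) : 'M[R]_n :=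
  diag_mx (\row_i (degree e i)%:R) - adjacency R e.

Definition ones (R : realType) n : 'cV[R]_n := const_mx 1.

Definition is_laplacian_pinv (R : realType) n (L X : 'M[R]_n) : Prop :=
  let P := 1%:M - n%:R^-1 *: (ones R n *m (ones R n)^T) in
  [/\ X^T = X, L *m X = P, X *m L = P & X *m ones R n = 0].

(* [xget] picks an element of the set; for L the Laplacian of a connected graph
   the set is a singleton, so the default value 0 is never used. *)
Definition laplacian_pinv (R : realType) n (e : rel 'I_n) : 'M[R]_n :=
  xget 0 [set X | is_laplacian_pinv (laplacian R e) X].

Definition resistance (R : realType) n (e : rel 'I_n) (i j : 'I_n) : R :=
  let Ld := laplacian_pinv R e in Ld i i + Ld j j - 2 * Ld i j.

Definition resistance_mx (R : realType) n (e : rel 'I_n) : 'M[R]_n :=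
  \matrix_(i, j) resistance R e i j.

(* [diag_mx] takes a row vector, hence the transpose. *)
Definition resistance_laplacian (R : realType) n (e : rel 'I_n) : 'M[R]_n :=
  diag_mx (resistance_mx R e *m ones R n)^T - resistance_mx R e.

Definition mean_diag (R : realType) n (e : rel 'I_n) : R :=
  n%:R^-1 * \tr (laplacian_pinv R e).

Definition resistance_deviation (R : realType) n (e : rel 'I_n) : 'M[R]_n :=
  diag_mx (\row_i laplacian_pinv R e i i) - (mean_diag R e)%:M.

(* The norm that MathComp-Analysis puts on matrices is the sup norm. *)
Definition euclidean_norm (R : realType) n (w : 'cV[R]_n) : R :=
  Num.sqrt (\sum_i w i 0 ^+ 2).

Definition unit_perp_ones (R : realType) n : set 'cV[R]_n :=
  [set w | (ones R n)^T *m w = 0 /\ euclidean_norm w = 1].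

Definition quad (R : realType) n (A : 'M[R]_n) (w : 'cV[R]_n) : R :=
  (w^T *m A *m w) 0 0.

Definition is_max (R : realType) (S : set R) (m : R) : Prop :=
  S m /\ ubound S m.

Definition spectrum (R : realType) n (A : 'M[R]_n) : set R :=
  [set a | eigenvalue A a].

(* Spectra are finite, so [sup] is the largest eigenvalue as soon as there is
   one; it is 0 if the spectrum is empty. *)
Definition lambda_max (R : realType) n (A : 'M[R]_n) : R := sup (spectrum A).

(* Main.v *)
Require Import Defs.
From mathcomp Require Import all_boot all_order all_algebra.
From mathcomp Require Import all_classical all_reals.
From mathcomp Require Import topology normedtype derive.
From mathcomp Require Import ring lra.

Import Order.TTheory GRing.Theory Num.Theory.
Import numFieldNormedType.Exports.
Local Open Scope classical_set_scope.
Local Open Scope ring_scope.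

(** Why the theorem holds. Effective resistances are values of the form of the
    pseudoinverse [X] of [L] at differences of basis vectors
    ([resistance_ge0]), and [X] is positive semidefinite because [L] is, so
    resistances are nonnegative. The resistance Laplacian is thus the
    Laplacian of a nonnegatively weighted complete graph: it is symmetric,
    positive semidefinite ([psd_weighted_laplacian]) and kills [1].

    For such a matrix the eigenvalue [0] of the vector [1] is the smallest one,
    so the largest eigenvalue is also the maximum of the form over unit vectors
    orthogonal to [1] ([rayleigh_perp_ones]). The maximum is attained by
    compactness of the sphere ([quad_attains_max]), and a maximiser is an
    eigenvector because [rho - A] is a positive semidefinite matrix whose form
    vanishes there ([psd_isotropic_ker]).

    The second formula is the first one shifted by a constant. As
    [r_ij = d_i + d_j - 2 X_ij], on unit vectors orthogonal to [1] the form of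
    the resistance Laplacian is [2 n] times the mean of the [d_i] plus the form
    of [2 X + n Delta] ([quad_resistance_laplacian]). *)

(** * Quadratic forms *)

Lemma quadE (R : realType) n (A : 'M[R]_n) w :
  quad A w = \sum_i \sum_j A i j * (w i 0 * w j 0).
Proof.
rewrite /quad mxE exchange_big /=; apply: eq_bigr => j _.
rewrite mxE mulr_suml; apply: eq_bigr => i _; rewrite mxE; ring.
Qed.

Lemma quadB (R : realType) n (A B : 'M[R]_n) w :
  quad (A - B) w = quad A w - quad B w.
Proof. by rewrite /quad mulmxBr mulmxBl !mxE. Qed.

Lemma quad_diag (R : realType) n (d : 'rV[R]_n) w :
  quad (diag_mx d) w = \sum_i d 0 i * w i 0 ^+ 2.
Proof.
rewrite quadE; apply: eq_bigr => i _.
rewrite (bigD1 i) //= big1 => [|j ji]; rewrite !mxE ?eqxx ?addr0 ?mulr1n //.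
by rewrite eq_sym (negbTE ji) mulr0n mul0r.
Qed.

Lemma quad_scalar (R : realType) n (a : R) (w : 'cV[R]_n) :
  quad a%:M w = a * \sum_i w i 0 ^+ 2.
Proof.
rewrite -diag_const_mx quad_diag mulr_sumr.
by apply: eq_bigr => i _; rewrite mxE.
Qed.

Lemma quadZr (R : realType) n (A : 'M[R]_n) c w :
  quad A (c *: w) = c ^+ 2 * quad A w.
Proof.
rewrite !quadE mulr_sumr; apply: eq_bigr => i _.
by rewrite mulr_sumr; apply: eq_bigr => j _; rewrite !mxE; ring.
Qed.

Lemma addmx11 (R : realType) (M N : 'M[R]_1) : (M + N) 0 0 = M 0 0 + N 0 0.
Proof. by rewrite mxE. Qed.

Lemma trmx11 (R : realType) (M : 'M[R]_1) : M^T 0 0 = M 0 0.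
Proof. by rewrite mxE. Qed.

Lemma quad_addr (R : realType) n (A : 'M[R]_n) u v : A^T = A ->
  quad A (u + v) = quad A u + 2 * (u^T *m (A *m v)) 0 0 + quad A v.
Proof.
move=> symA; rewrite /quad [(u + v)^T]linearD /= !mulmxDl !mulmxDr !addmx11.
rewrite -!mulmxA.
have -> : (v^T *m (A *m u)) 0 0 = (u^T *m (A *m v)) 0 0.
  by rewrite -[LHS]trmx11 !trmx_mul trmxK symA mulmxA.
ring.
Qed.

Lemma sqnormE (R : realType) n (w : 'cV[R]_n) :
  (w^T *m w) 0 0 = \sum_i w i 0 ^+ 2.
Proof. by rewrite mxE; apply: eq_bigr => i _; rewrite mxE expr2. Qed.

Lemma sqnorm_ge0 (R : realType) n (w : 'cV[R]_n) :
  0 <= \sum_i w i 0 ^+ 2.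
Proof. by apply: sumr_ge0 => i _; exact: sqr_ge0. Qed.

Lemma sqnorm_eq0 (R : realType) n (w : 'cV[R]_n) :
  \sum_i w i 0 ^+ 2 = 0 -> w = 0.
Proof.
move=> /eqP; rewrite psumr_eq0 => [/allP w0|i _]; last exact: sqr_ge0.
apply/colP => i; rewrite mxE; apply/eqP; rewrite -sqrf_eq0.
exact: (w0 i (mem_index_enum i)).
Qed.

(** A point where a nonnegative quadratic form vanishes is a minimum, so the
    first variation vanishes there: in the direction [- t B w] it is
    [- 2 t |B w|^2], which cannot be compensated by the second-order term
    for small [t]. *)
Lemma psd_isotropic_ker (R : realType) n (B : 'M[R]_n) w :
  B^T = B -> (forall v, 0 <= quad B v) -> quad B w = 0 -> B *m w = 0.
Proof.
move=> symB psdB Bw0; set u := B *m w.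
apply: sqnorm_eq0; rewrite -sqnormE; set s := (u^T *m u) 0 0.
have s_ge0 : 0 <= s by rewrite /s sqnormE sqnorm_ge0.
have q_ge0 := psdB u; set q := quad B u in q_ge0.
have var t : 0 <= - (2 * t * s) + t ^+ 2 * q.
  have := psdB (w + (- t) *: u).
  rewrite quad_addr // Bw0 quadZr -/q sqrrN.
  rewrite -!scalemxAr mulmxA -{1}symB -trmx_mul -/u [X in _ + 2 * X]mxE -/s.
  by rewrite add0r mulNr mulrN mulrA.
(* With this step the bound is [- s ^ 2 * (q + 2) / (q + 1) ^ 2], also if
   [q = 0]. *)
have {}var := var (s / (q + 1)).
apply/eqP; rewrite -sqrf_eq0 eq_le sqr_ge0 andbT.
have q1 : 0 < q + 1 by lra.
have : 0 <= (- (2 * (s / (q + 1)) * s) + (s / (q + 1)) ^+ 2 * q) * (q + 1) ^+ 2.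
  by rewrite mulr_ge0 // sqr_ge0.
have -> : (- (2 * (s / (q + 1)) * s) + (s / (q + 1)) ^+ 2 * q) * (q + 1) ^+ 2
   = - (s ^+ 2 * (q + 2)) by field; rewrite gt_eqF.
rewrite oppr_ge0 => h; rewrite -(ler_pM2r (_ : 0 < q + 2)) ?mul0r //; lra.
Qed.

(** * Maximising a quadratic form on the unit sphere of the hyperplane *)

Lemma dot_ones (R : realType) n (w : 'cV[R]_n) :
  ((ones R n)^T *m w) 0 0 = \sum_i w i 0.
Proof. by rewrite mxE; apply: eq_bigr => i _; rewrite !mxE mul1r. Qed.

Lemma unit_perp_onesP (R : realType) n (w : 'cV[R]_n) :
  unit_perp_ones w <-> \sum_i w i 0 = 0 /\ \sum_i w i 0 ^+ 2 = 1.
Proof.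
rewrite /unit_perp_ones /euclidean_norm /=; split=> -[w1 wn]; split.
- by rewrite -dot_ones w1 mxE.
- by rewrite -[LHS]sqr_sqrtr ?wn ?expr1n // sqnorm_ge0.
- by apply/matrixP => i j; rewrite !ord1 dot_ones w1 mxE.
- by rewrite wn sqrtr1.
Qed.

Lemma unit_perp_ones_neq0 (R : realType) n : (2 <= n)%N ->
  @unit_perp_ones R n !=set0.
Proof.
case: n => [|[|n]] // _.
have sum01 (F : 'I_n.+2 -> R) : (forall i, i != 0 -> i != 1 -> F i = 0) ->
    \sum_i F i = F 0 + F 1.
  move=> F0; rewrite (bigD1 0) //= (bigD1 1) //= big1 ?addr0 // => i /andP[].
  exact: F0.
exists (\col_i ((Num.sqrt 2)^-1 * ((i == 0)%:R - (i == 1)%:R))).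
apply/unit_perp_onesP; rewrite !sum01; first last.
- by move=> i /negbTE i0 /negbTE i1; rewrite mxE i0 i1 subrr mulr0 ?expr0n.
- by move=> i /negbTE i0 /negbTE i1; rewrite mxE i0 i1 subrr mulr0 ?expr0n.
rewrite !mxE /= subr0 sub0r mulrN mulr1 subrr sqrrN exprVn sqr_sqrtr //.
split=> //; lra.
Qed.

Lemma continuous_sum_real (R : realType) (T : topologicalType) (I : finType)
    (F : I -> T -> R) :
  (forall i, continuous (F i)) -> continuous (fun x => \sum_i F i x).
Proof.
by move=> cF; apply: continuous_big => // ; exact: add_continuous.
Qed.

(** The sphere is a closed subset of the cube [[-1, 1]^n], hence compact; the
    argument runs on transposes, as the Tychonoff lemma [rV_compact] concerns
    row vectors. *)
Lemma quad_attains_max (R : realType) n (A : 'M[R]_n) : (2 <= n)%N ->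
  exists2 w, unit_perp_ones w
    & forall v, unit_perp_ones v -> quad A v <= quad A w.
Proof.
move=> n2; pose S := [set v : 'rV[R]_n | unit_perp_ones v^T].
pose f (v : 'rV[R]_n) : R := \sum_i \sum_j A i j * (v 0 i * v 0 j).
have coordc i : continuous (fun v : 'rV[R]_n => v 0 i).
  exact: coord_continuous.
have fE v : f v^T = quad A v.
  by rewrite quadE; apply: eq_bigr => i _; apply: eq_bigr => j _; rewrite !mxE.
have contf : continuous f.
  apply: continuous_sum_real => i; apply: continuous_sum_real => j v.
exact: cvgM (cvg_cst _) (cvgM (coordc i v) (coordc j v)).
have SE : S = (fun v : 'rV[R]_n => \sum_i v 0 i) @^-1` [set x | x = 0]
          `&` (fun v : 'rV[R]_n => \sum_i v 0 i ^+ 2) @^-1` [set x | x = 1].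
  apply/seteqP; split=> v /= [v1 v2].
    have [w1 w2] := proj1 (unit_perp_onesP R n v^T) (conj v1 v2).
    by split; [apply: etrans w1 | apply: etrans w2];
      apply: eq_bigr => i _; rewrite mxE.
  apply/unit_perp_onesP.
  by split; [apply: etrans v1 | apply: etrans v2];
    apply: eq_bigr => i _; rewrite mxE.
have closed_fiber (F : 'I_n -> 'rV[R]_n -> R) a :
    (forall i, continuous (F i)) ->
    closed ((fun v => \sum_i F i v) @^-1` [set x | x = a]).
  move=> cF; have /continuous_closedP := continuous_sum_real R _ _ F cF.
  by apply; exact: closed_eq.
have clS : closed S.
  rewrite SE; apply: closedI; apply: closed_fiber => i //.
  by move=> v; exact: cvgM (coordc i v) (coordc i v).
have cS : compact S.
  apply: (subclosed_compact clS (rV_compact (fun=> @segment_compact R (-1) 1))).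
  rewrite SE => v /= [_ v2] i; rewrite in_itv /= -ler_norml.
  rewrite -(ler_pXn2r (_ : 0 < 2)%N) ?nnegrE // expr1n real_normK ?num_real //.
  rewrite -v2 (bigD1 i) //= lerDl; apply: sumr_ge0 => j _; exact: sqr_ge0.
have S0 : S !=set0.
  by have [w wS] := unit_perp_ones_neq0 R n n2; exists w^T; rewrite /S /= trmxK.
have [c cS' maxc] := compact_EVT_max S0 cS (continuous_subspaceT contf).
exists c^T; first by move: cS'; rewrite inE.
by move=> v vS; rewrite -!fE trmxK; apply: maxc; rewrite inE /S /= trmxK.
Qed.

(** A vector splits as a multiple of [1] plus a vector orthogonal to [1]. The
    first part is killed by [A], and removing it only shortens the vector, so
    the bound on the sphere spreads to all vectors, provided it is
    nonnegative. *)
Lemma quad_le_of_unit_perp (R : realType) n (A : 'M[R]_n) (rho : R) :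
  A^T = A -> A *m ones R n = 0 -> 0 <= rho ->
  (forall w, unit_perp_ones w -> quad A w <= rho) ->
  forall v, quad A v <= rho * \sum_i v i 0 ^+ 2.
Proof.
move=> symA A1 rho0 bound v.
have [n0|n_gt0] := posnP n.
  by subst n; rewrite quadE !big_ord0 mulr0.
pose c := n%:R^-1 * \sum_i v i 0; pose u := v - c *: ones R n.
have nc : n%:R * c = \sum_i v i 0.
  by rewrite /c mulrA mulfV ?mul1r // pnatr_eq0 -lt0n.
have uE i : u i 0 = v i 0 - c by rewrite !mxE mulr1.
have u1 : \sum_i u i 0 = 0.
  rewrite (eq_bigr _ (fun i _ => uE i)) sumrB sumr_const card_ord -mulr_natl.
  by rewrite nc subrr.
have vE : v = u + c *: ones R n by rewrite subrK.
have quv : quad A v = quad A u.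
  rewrite {1}vE quad_addr // -scalemxAr A1 scaler0 mulmx0 mxE mulr0 addr0.
  by rewrite quadZr [X in _ * X]/quad -mulmxA A1 mulmx0 mxE mulr0 addr0.
have uv : \sum_i u i 0 ^+ 2 <= \sum_i v i 0 ^+ 2.
  rewrite (eq_bigr (fun i => v i 0 ^+ 2 - 2 * c * v i 0 + c ^+ 2)); last first.
    by move=> i _; rewrite uE; ring.
  rewrite big_split sumrB /= -mulr_sumr sumr_const card_ord -mulr_natl -nc.
  have : 0 <= n%:R * c ^+ 2 by rewrite mulr_ge0 // sqr_ge0.
  lra.
rewrite quv; apply: le_trans (ler_wpM2l rho0 uv).
set N := \sum_i _.
have [N0|N_neq0] := eqVneq N 0.
  by rewrite (sqnorm_eq0 _ _ _ N0) /quad mulmx0 mxE mulr_ge0 ?sqnorm_ge0.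
have N_gt0 : 0 < N by rewrite lt_def N_neq0 sqnorm_ge0.
have := bound ((Num.sqrt N)^-1 *: u).
rewrite quadZr exprVn sqr_sqrtr ?(ltW N_gt0) //
     ler_pdivrMl // mulrC; apply.
apply/unit_perp_onesP; split.
  rewrite (eq_bigr (fun i => (Num.sqrt N)^-1 * u i 0)); last first.
    by move=> i _; rewrite mxE.
  by rewrite -mulr_sumr u1 mulr0.
rewrite (eq_bigr (fun i => N^-1 * u i 0 ^+ 2)) => [|i _].
  by rewrite -mulr_sumr mulVf.
by rewrite mxE exprMn exprVn sqr_sqrtr ?ltW.
Qed.

(** Rayleigh's principle for a positive semidefinite [A] that kills [1]: the
    kernel vector [1] may be left out because its eigenvalue is the smallest
    one. If [rho] is the maximum over the sphere then [rho - A] is positive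
    semidefinite and its form vanishes at the maximiser, which is therefore an
    eigenvector. *)
Lemma rayleigh_perp_ones (R : realType) n (A : 'M[R]_n) :
  (2 <= n)%N -> A^T = A -> A *m ones R n = 0 -> (forall v, 0 <= quad A v) ->
  exists2 rho, is_max (spectrum A) rho
             & is_max [set quad A w | w in @unit_perp_ones R n] rho.
Proof.
move=> n2 symA A1 psdA; have [w wS maxw] := quad_attains_max R n A n2.
have le_rho := quad_le_of_unit_perp R n A _ symA A1 (psdA w) maxw.
have [_ w2] := proj1 (unit_perp_onesP R n w) wS.
set rho := quad A w in le_rho maxw *; exists rho; last first.
  by split; [exists w | move=> _ [v vS <-]; exact: maxw].
split=> [|a /eigenvalueP[v vA v0]].
  have Bw : (rho%:M - A) *m w = 0.
    apply: psd_isotropic_ker.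
    - by rewrite raddfB /= tr_scalar_mx symA.
    - by move=> v; rewrite quadB quad_scalar subr_ge0.
    - by rewrite quadB quad_scalar w2 mulr1 subrr.
  apply/eigenvalueP; exists w^T.
    rewrite -{1}symA -trmx_mul -linearZ /=; congr (_^T).
    by move/eqP: Bw; rewrite mulmxBl mul_scalar_mx subr_eq0 => /eqP.
  rewrite trmx_eq0; apply/eqP => w0; move: w2; rewrite w0 big1 => [/eqP|i _].
    by rewrite eq_sym oner_eq0.
  by rewrite mxE expr0n.
have := le_rho v^T.
rewrite {1}/quad trmxK vA -scalemxAl mxE -{1}[v]trmxK sqnormE ler_pM2r //.
rewrite lt_def sqnorm_ge0 andbT; apply: contra_neq v0 => /sqnorm_eq0 v0.
by rewrite -[v]trmxK v0 trmx0.
Qed.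

Lemma sup_is_max (R : realType) (S : set R) m : is_max S m -> sup S = m.
Proof.
move=> [Sm ubm]; apply/eqP; rewrite eq_le ge_sup //=; last by exists m.
by apply: ub_le_sup => //; exists m.
Qed.

(** * Weighted Laplacians *)

Lemma mul_ones (R : realType) n (A : 'M[R]_n) i :
  (A *m ones R n) i 0 = \sum_j A i j.
Proof. by rewrite mxE; apply: eq_bigr => j _; rewrite mxE mulr1. Qed.

(** Both Laplacians of the theorem have this shape, with the adjacency matrix
    and the resistance matrix as weights. *)
Definition weighted_laplacian (R : realType) n (A : 'M[R]_n) : 'M[R]_n :=
  diag_mx (A *m ones R n)^T - A.

Lemma tr_weighted_laplacian (R : realType) n (A : 'M[R]_n) :
  A^T = A -> (weighted_laplacian R n A)^T = weighted_laplacian R n A.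
Proof. by move=> symA; rewrite raddfB /= tr_diag_mx symA. Qed.

Lemma weighted_laplacian_ones (R : realType) n (A : 'M[R]_n) :
  weighted_laplacian R n A *m ones R n = 0.
Proof.
rewrite mulmxBl mul_diag_mx; apply/matrixP => i j.
by rewrite !ord1 !mxE mulr1 subrr.
Qed.

Lemma quad_weighted_laplacian (R : realType) n (A : 'M[R]_n) w : A^T = A ->
  quad (weighted_laplacian R n A) w
    = 2^-1 * \sum_i \sum_j A i j * (w i 0 - w j 0) ^+ 2.
Proof.
move=> symA; rewrite quadB quad_diag quadE.
have -> : \sum_i (A *m ones R n)^T 0 i * w i 0 ^+ 2
          = \sum_i \sum_j A i j * w i 0 ^+ 2.
  by apply: eq_bigr => i _; rewrite mxE mul_ones mulr_suml.
have sw : \sum_i \sum_j A i j * w j 0 ^+ 2 = \sum_i \sum_j A i j * w i 0 ^+ 2.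
  rewrite exchange_big; apply: eq_bigr => i _; apply: eq_bigr => j _.
  by rewrite -{1}symA mxE.
have -> : \sum_i \sum_j A i j * (w i 0 - w j 0) ^+ 2
   = \sum_i \sum_j A i j * w i 0 ^+ 2
     - 2 * \sum_i \sum_j A i j * (w i 0 * w j 0)
     + \sum_i \sum_j A i j * w j 0 ^+ 2.
  rewrite mulr_sumr -sumrB -big_split; apply: eq_bigr => i _.
  rewrite mulr_sumr -sumrB -big_split; apply: eq_bigr => j _ /=; ring.
rewrite sw; lra.
Qed.

Lemma psd_weighted_laplacian (R : realType) n (A : 'M[R]_n) : A^T = A ->
  (forall i j, 0 <= A i j) -> forall w, 0 <= quad (weighted_laplacian R n A) w.
Proof.
move=> symA A0 w; rewrite quad_weighted_laplacian // mulr_ge0 ?invr_ge0 //.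
by apply: sumr_ge0 => i _; apply: sumr_ge0 => j _; rewrite mulr_ge0 ?sqr_ge0.
Qed.

(** * The pseudoinverse of the Laplacian of a connected graph *)

Lemma laplacianE (R : realType) n (e : rel 'I_n) :
  laplacian R e = weighted_laplacian R n (adjacency R e).
Proof.
congr (diag_mx _ - _); apply/rowP => i; rewrite !mxE /degree cardsE -sum1_card.
rewrite natr_sum big_mkcond /=; apply: eq_bigr => j _.
by rewrite !mxE mulr1 unfold_in /=; case: (e i j).
Qed.

Lemma tr_adjacency (R : realType) n (e : rel 'I_n) :
  symmetric e -> (adjacency R e)^T = adjacency R e.
Proof. by move=> syme; apply/matrixP => i j; rewrite !mxE syme. Qed.

Lemma psd_laplacian (R : realType) n (e : rel 'I_n) w :
  symmetric e -> 0 <= quad (laplacian R e) w.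
Proof.
move=> syme; rewrite laplacianE psd_weighted_laplacian ?tr_adjacency //.
by move=> i j; rewrite mxE.
Qed.

(** The Dirichlet energy vanishes only if each edge joins equal values, hence
    only for constants when the graph is connected. *)
Lemma laplacian_isotropic_const (R : realType) n (e : rel 'I_n) (w : 'cV[R]_n) :
  symmetric e -> connected_graph e -> quad (laplacian R e) w = 0 ->
  forall i j, w i 0 = w j 0.
Proof.
move=> syme conn; rewrite laplacianE quad_weighted_laplacian ?tr_adjacency //.
move=> /eqP; rewrite mulf_eq0 invr_eq0 pnatr_eq0 /=.
have term0 i j : 0 <= adjacency R e i j * (w i 0 - w j 0) ^+ 2.
  by rewrite mxE mulr_ge0 ?sqr_ge0.
rewrite psumr_eq0 => [/allP w0|i _]; last by apply: sumr_ge0 => j _.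
have edge i j : e i j -> w i 0 = w j 0.
  move=> eij; have := w0 i (mem_index_enum i).
  rewrite /= psumr_eq0 // => /allP/(_ j (mem_index_enum j)) /=.
  by rewrite mxE eij mul1r sqrf_eq0 subr_eq0 => /eqP.
(* The level sets of [w] are unions of connected components. *)
have level i : fingraph.closed e [pred j | w i 0 == w j 0].
  by move=> j k /edge; rewrite !inE => ->.
move=> i j; apply/eqP; have := closed_connect (level i) (conn i j).
by rewrite !inE eqxx => <-.
Qed.

Lemma ones_gram (R : realType) n : (ones R n)^T *m ones R n = n%:R%:M.
Proof.
apply/matrixP => i j; rewrite !ord1 dot_ones (eq_bigr (fun=> 1)); last first.
  by move=> k _; rewrite mxE.
by rewrite sumr_const card_ord mxE eqxx mulr1n.
Qed.

(** With [J] the projection on [1], the matrix [L + J] is invertible since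
    [L] and [J] are positive semidefinite with kernels meeting in [0]; it is
    the identity on [1], and [(L + J)^-1 - J] is the pseudoinverse. *)
Lemma laplacian_pinvP (R : realType) n (e : rel 'I_n) : (0 < n)%N ->
  symmetric e -> connected_graph e ->
  is_laplacian_pinv (laplacian R e) (laplacian_pinv R e).
Proof.
move=> n0 syme conn; rewrite /laplacian_pinv.
set L := laplacian R e; set c := n%:R^-1 : R; set o := ones R n.
have nn0 : n%:R != 0 :> R by rewrite pnatr_eq0 -lt0n.
have symL : L^T = L.
  by rewrite /L laplacianE tr_weighted_laplacian ?tr_adjacency.
have Lo : L *m o = 0 by rewrite /L laplacianE weighted_laplacian_ones.
pose J := c *: (o *m o^T).
have symJ : J^T = J by rewrite /J linearZ /= trmx_mul trmxK.
have Jo : J *m o = o.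
  rewrite /J -scalemxAl -mulmxA ones_gram mul_mx_scalar scalerA mulVf //.
  exact: scale1r.
have LJ : L *m J = 0 by rewrite /J -scalemxAr mulmxA Lo mul0mx scaler0.
have JJ : J *m J = J.
  by rewrite {2}/J -scalemxAr mulmxA Jo.
have quadJ w : quad J w = c * (\sum_i w i 0) ^+ 2.
  rewrite /quad /J -scalemxAr -scalemxAl mxE; congr (_ * _).
  rewrite -mulmxA -mulmxA mulmxA mxE big_ord1 dot_ones expr2; congr (_ * _).
  by rewrite -[LHS]trmx11 trmx_mul trmxK dot_ones.
have quadJ_ge0 w : 0 <= quad J w by rewrite quadJ mulr_ge0 ?sqr_ge0 ?invr_ge0.
pose M := L + J.
have symM : M^T = M by rewrite raddfD /= symL symJ.
have Mu : M \in unitmx.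
  rewrite -row_free_unit; apply: inj_row_free => v vM.
  have qM : quad L v^T + quad J v^T = 0.
    by rewrite /quad trmxK -addmx11 -mulmxDl -mulmxDr vM mul0mx mxE.
  have qL := psd_laplacian R n e v^T syme; have qJ := quadJ_ge0 v^T.
  have vconst : forall i j, v^T i 0 = v^T j 0.
    by apply: (laplacian_isotropic_const R n e) => //; rewrite -/L in qL *; lra.
  have : quad J v^T = 0 by rewrite -/L in qL; lra.
  rewrite quadJ => /eqP; rewrite mulf_eq0 invr_eq0 (negbTE nn0) sqrf_eq0 /=.
  move=> /eqP sum0; apply/rowP => i; rewrite [RHS]mxE.
  rewrite (eq_bigr (fun=> v 0 i)) in sum0; last first.
    by move=> j _; rewrite (vconst j i) mxE.
  move/eqP: sum0; rewrite sumr_const card_ord -mulr_natl mulf_eq0 (negbTE nn0).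
  by move/eqP.
have MJ : M *m J = J by rewrite mulmxDl LJ JJ add0r.
have iMo : invmx M *m o = o.
  have {1}<- : M *m o = o by rewrite mulmxDl Lo Jo add0r.
  by rewrite mulmxA mulVmx ?mul1mx.
have iMJ : invmx M *m J = J by rewrite /J -scalemxAr mulmxA iMo.
have LE : L = M - J by rewrite /M addrK.
pose X := invmx M - J.
have symX : X^T = X by rewrite /X raddfB /= trmx_inv symM symJ.
have LX : L *m X = 1%:M - J.
  rewrite LE mulmxBl /X mulmxBr (mulmxV Mu) MJ mulmxBr JJ.
  have -> : J *m invmx M = J.
    by rewrite -[LHS]trmxK trmx_mul symJ trmx_inv symM iMJ symJ.
  by rewrite subrr subr0.
have XL : X *m L = 1%:M - J.
  by rewrite -symX -{1}symL -trmx_mul LX raddfB /= trmx1 symJ.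
apply: (@xgetPex _ 0 [set X | is_laplacian_pinv L X]); exists X; split => //.
by rewrite /X mulmxBl iMo Jo subrr.
Qed.

(** * The resistance Laplacian *)

Section Resistance.
Context (R : realType) (n : nat) (e : rel 'I_n).
Hypotheses (n_gt0 : (0 < n)%N) (syme : symmetric e) (conn : connected_graph e).
Let X := laplacian_pinv R e.

Lemma tr_laplacian_pinv : X^T = X.
Proof. by case: (laplacian_pinvP R n e n_gt0 syme conn). Qed.

Lemma laplacian_pinv_ones : X *m ones R n = 0.
Proof. by case: (laplacian_pinvP R n e n_gt0 syme conn). Qed.

(** [X = X L X] exhibits the form of [X] at [w] as that of [L] at [X w]. *)
Lemma psd_laplacian_pinv w : 0 <= quad X w.
Proof.
have [symX _ XL X1] := laplacian_pinvP R n e n_gt0 syme conn.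
rewrite -/X in symX XL X1.
have XLX : X *m laplacian R e *m X = X.
  rewrite XL mulmxBl mul1mx -scalemxAl -mulmxA.
  by rewrite -[X in _ *m (_ *m X)]symX -trmx_mul X1 trmx0 mulmx0 scaler0 subr0.
have -> : quad X w = quad (laplacian R e) (X *m w).
  by rewrite /quad trmx_mul symX -{1}XLX !mulmxA.
exact: psd_laplacian.
Qed.

Lemma resistanceC i j : resistance R e i j = resistance R e j i.
Proof.
rewrite /resistance -/X [X i i + _]addrC; congr (_ - 2 * _).
by rewrite -[in LHS]tr_laplacian_pinv mxE.
Qed.

(** The resistance between [i] and [j] is the form of [X] at the difference of
    the two basis vectors. *)
Lemma resistance_ge0 i j : 0 <= resistance R e i j.
Proof.
pose b k : 'cV[R]_n := delta_mx k 0.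
have entry k l : ((b k)^T *m (X *m b l)) 0 0 = X k l.
  by rewrite -colE trmx_delta -rowE !mxE.
have := psd_laplacian_pinv (b i - b j).
rewrite -scaleN1r quad_addr ?tr_laplacian_pinv // quadZr -!scalemxAr.
rewrite /quad -!(mulmxA _ X) [X in _ + 2 * X]mxE !entry /resistance -/X.
lra.
Qed.

Lemma tr_resistance_mx : (resistance_mx R e)^T = resistance_mx R e.
Proof. by apply/matrixP => i j; rewrite !mxE resistanceC. Qed.

(** The rows of [X] sum to [0], so the cross terms [- 2 X_ij] drop out. *)
Lemma resistance_mx_ones i :
  (resistance_mx R e *m ones R n) i 0 = n%:R * (X i i + mean_diag R e).
Proof.
rewrite mul_ones (eq_bigr (fun j => X i i + X j j - 2 * X i j)); last first.
  by move=> j _; rewrite mxE.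
rewrite sumrB big_split /= -mulr_sumr -mul_ones laplacian_pinv_ones mxE.
rewrite sumr_const card_ord -[X i i *+ n]mulr_natl mulr0 subr0 mulrDr.
congr (_ + _).
by rewrite /mean_diag mulVKf // pnatr_eq0 -lt0n.
Qed.

(** On the hyperplane the rank-one parts [d_i] and [d_j] of [r_ij] contribute
    nothing, so the resistance matrix acts there as [- 2 X]. *)
Lemma quad_resistance_laplacian w : unit_perp_ones w ->
  quad (resistance_laplacian R e) w
    = 2 * n%:R * mean_diag R e
      + (2 * quad X w + n%:R * quad (resistance_deviation R e) w).
Proof.
move=> /unit_perp_onesP[w1 w2].
rewrite /resistance_laplacian /resistance_deviation !quadB quad_scalar w2.
have -> : quad (resistance_mx R e) w = - 2 * quad X w.
  rewrite !quadE.
  rewrite (eq_bigr (fun i => (X i i * w i 0) * (\sum_j w j 0)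
      + w i 0 * (\sum_j X j j * w j 0)
      - 2 * \sum_j X i j * (w i 0 * w j 0))); last first.
    move=> i _; rewrite !mulr_sumr -big_split -sumrB; apply: eq_bigr => j _.
    by rewrite mxE /resistance -/X /=; ring.
  rewrite sumrB big_split /= -!mulr_suml w1 mulr0 mul0r !add0r -mulr_sumr.
  by rewrite mulNr.
rewrite !quad_diag.
rewrite (eq_bigr (fun i => n%:R * (X i i * w i 0 ^+ 2)
    + n%:R * mean_diag R e * w i 0 ^+ 2)); last first.
  by move=> i _; rewrite mxE resistance_mx_ones; ring.
rewrite big_split /= -!mulr_sumr w2.
rewrite (eq_bigr (fun i => (\row_i X i i) 0 i * w i 0 ^+ 2)); last first.
  by move=> i _; rewrite mxE.
rewrite /X; ring.
Qed.

End Resistance.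

Theorem theorem2p14 (R : realType) (n : nat) (e : rel 'I_n)
    (hn : (2 <= n)%N) (hsimple : simple_graph e) (hconn : connected_graph e) :
  let Res := resistance_laplacian R e in
  let rho := lambda_max Res in
  [/\ is_max (spectrum Res) rho,
      is_max [set quad Res w | w in @unit_perp_ones R n] rho
    & exists2 m : R,
        is_max [set 2 * quad (laplacian_pinv R e) w
                    + n%:R * quad (resistance_deviation R e) w
               | w in @unit_perp_ones R n] m
        & rho = 2 * n%:R * mean_diag R e + m].
Proof.
move=> Res rho; have [syme _] := hsimple.
have n_gt0 : (0 < n)%N by exact: ltnW.
have symRm := tr_resistance_mx R n e n_gt0 syme hconn.
have [r maxspec maxquad] : exists2 r, is_max (spectrum Res) r
    & is_max [set quad Res w | w in @unit_perp_ones R n] r.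
  apply: rayleigh_perp_ones => //.
  - exact: tr_weighted_laplacian.
  - exact: weighted_laplacian_ones.
  - apply: psd_weighted_laplacian => // i j; rewrite mxE; exact: resistance_ge0.
have -> : rho = r by exact: sup_is_max.
split => //; have resE := quad_resistance_laplacian R n e n_gt0 syme hconn.
exists (r - 2 * n%:R * mean_diag R e); last by rewrite addrC subrK.
have [[w wS wr] ub] := maxquad; split.
  by exists w => //; rewrite -wr resE // addrAC subrr add0r.
move=> _ [v vS <-]; rewrite lerBrDl -resE //; apply: ub; by exists v.
Qed.
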